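(* The set of smooth (i.e. having derivatives of all orders) and nowhere analytic functions $g:\mathbb{R}\to\mathbb{R}$ is strongly $\mathfrak{c}$-algebrable (as a subset of the algebra $\mathbb{R}^{\mathbb{R}}$).
   Context: $\mathfrak{c}=2^{\omega}$ is the cardinality of the continuum. $\mathbb{R}^{\mathbb{R}}$ is the real commutative algebra of all functions $\mathbb{R}\to\mathbb{R}$ with pointwise operations. A subset $S$ of a commutative real algebra $\mathcal{L}$ is strongly $\kappa$-algebrable if $S\cup\{0\}$ contains a $\kappa$-generated algebra isomorphic to a free (commutative, non-unital) algebra; equivalently, there is a set $X\subseteq\mathcal{L}$ of cardinality $\kappa$ such that for every $k\ge 1$, every nonzero real polynomial $P$ in $k$ variables without constant term and all distinct $y_1,\dots,y_k\in X$, we have $P(y_1,\dots,y_k)\neq 0$ and $P(y_1,\dots,y_k)\in S$. A function $g:\mathbb{R}\to\mathbb{R}$ is analytic at $x_0$ if on some neighbourhood of $x_0$ it is given by a convergent power series centred at $x_0$; it is nowhere analytic if it is not analytic at any point of $\mathbb{R}$. *)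

(* Defs.v *)
From HB Require Import structures.
From mathcomp Require Import all_boot all_order all_algebra.
From mathcomp Require Import all_classical all_reals all_analysis.
(* The notations of [mpoly] clash with those of MathComp-Analysis, hence the
   plain names below: [mpoly k R] is {mpoly R[k]}, [mcoeff m P] is P@_m,
   [mnm0] is the zero multinomial. *)
From mathcomp Require Import -(notations) mpoly.

Set Implicit Arguments.
Unset Strict Implicit.
Unset Printing Implicit Defensive.

Import Order.TTheory GRing.Theory Num.Theory.
Import numFieldNormedType.Exports.

Local Open Scope classical_set_scope.
Local Open Scope card_scope.
Local Open Scope ring_scope.

Section fct_algebra.
Context (T : pointedType) (R : realType).
Implicit Types (a : R) (f g : T -> R).

Fact fct_scalerAl a f g : a *: (f * g) = (a *: f) * g.
Proof. by apply/funext => x; exact: mulrA. Qed.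

HB.instance Definition _ :=
  GRing.Lmodule_isLalgebra.Build R (T -> R) fct_scalerAl.

Fact fct_scalerAr a f g : a *: (f * g) = f * (a *: g).
Proof. by apply/funext => x; exact: mulrCA. Qed.

HB.instance Definition _ :=
  GRing.Lalgebra_isAlgebra.Build R (T -> R) fct_scalerAr.

End fct_algebra.

(* A type with 2 ^ omega elements. *)
Definition continuum : Type := nat -> bool.

(* The cardinal kappa is given by a type having that cardinality. The value
   P(y_1, ..., y_k) in L is [mmap (in_alg L) y P], real coefficients acting as
   multiples of the unit of L. *)
Definition strongly_algebrable (R : realType) (L : comAlgType R)
    (kappa : Type) (S : set L) : Prop :=
  exists X : set L, X #= [set: kappa] /\
    forall (k : nat) (P : mpoly k R) (y : 'I_k -> L),
      (1 <= k)%N -> P != 0 -> mcoeff mnm0 P = 0 ->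
      injective y -> (forall i, X (y i)) ->
      mmap (in_alg L) y P <> 0 /\ S (mmap (in_alg L) y P).

Arguments strongly_algebrable {R} L kappa S.

Lemma mmap_fctE (R : realType) (k : nat) (P : mpoly k R)
    (y : 'I_k -> (R -> R)) (x : R) :
  mmap (in_alg ((R -> R) : comAlgType R)) y P x = meval (fun i => y i x) P.
Proof.
rewrite /meval /mmap fct_sumE; apply: eq_bigr => m _.
rewrite /GRing.in_alg /mmap1 /= {1}/GRing.mul /=.
congr (_ * _); first exact: mulr1.
elim/big_ind2: _ => //; first by move=> a a' b b' <- <-.
by move=> i _; elim: (m i) => // n IH; rewrite !exprS -IH.
Qed.

Definition smooth (R : realType) (g : R -> R) : Prop :=
  forall (n : nat) (x : R), derivable (derive1n n g) x 1.

Definition analytic_at (R : realType) (g : R -> R) (x0 : R) : Prop :=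
  exists a : nat -> R,
    \forall x \near x0, pseries a (x - x0) @ \oo --> g x.

Definition nowhere_analytic (R : realType) (g : R -> R) : Prop :=
  forall x0 : R, ~ analytic_at g x0.

(* Main.v *)
Require Import Defs.
From mathcomp Require Import all_boot all_order all_algebra.
From mathcomp Require Import all_classical all_reals all_analysis.
From mathcomp Require Import -(notations) mpoly.
From mathcomp Require Import ring lra.

Set Implicit Arguments.
Unset Strict Implicit.
Unset Printing Implicit Defensive.

Import Order.TTheory GRing.Theory Num.Theory.
Import numFieldNormedType.Exports.

Local Open Scope classical_set_scope.
Local Open Scope ring_scope.

(** The generators are the functions exp f_b, for b an infinite binary sequence,
where f_b is a superlacunary series

  f_b(x) = sum over k in S_b of lam_k ^ (-k) * cos (lam_k x - (k + 1) pi / 2),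

S_b is the set of codes of the finite prefixes of b, and the frequencies lam_k
are powers of 2 that grow so fast that, for n = k + 1, the n-th derivative of
the k-th wave dwarfs everything else.  Two distinct sequences share only
finitely many prefixes, so the sets S_b are infinite and almost disjoint: given
finitely many distinct b_i and an index i0, infinitely many k belong to
S_(b_i0) and to no other S_(b_i) (prefix_code_separation).  For such a k, all
derivatives of order < n of all the f_b, and the n-th derivative of the other
f_(b_i), are bounded by a constant M depending on lam_0, ..., lam_(k-1) only
(lacunary_lower_derivative, lacunary_silent), whereas at every x in a dense set
the n-th derivative of f_(b_i0) is at least n! (n M) ^ n (lacunary_peak).

A polynomial without constant term in the generators is a finite sum
G = sum_m w_m exp F_m, over nonzero exponents m, where
F_m = sum_i m_i f_(b_i).  The Leibniz rule for (exp F)' = F' exp F shows that the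
n-th derivative of exp F is F^(n) exp F up to an error controlled by the lower
derivatives of F (jet_bound_expR).  So, for k as above,

  G^(n) = f_(b_i0)^(n) * (sum_m w_m m_i0 exp F_m) + O (n! (d M) ^ n)

with d independent of n.  If G were analytic at x0, its n-th derivative would
be O (n! r ^ n) on a neighbourhood U of x0 (analytic_jet_bound).  Comparing the
orders of growth, sum_m w_m m_i0 exp F_m vanishes on a dense subset of U, hence
on U (expsum_weight).  This sum is again of the same form and, being zero on U,
it satisfies the same bounds there; so multiplying the weights w_m by further
coordinates m_i, and by linear combinations of such products, gives sums that
vanish on U too.  Choosing a polynomial in m that kills all exponents but one,
a single term w_m q(m) exp F_m with w_m q(m) <> 0 vanishes at x0, which is
absurd (expsum_not_analytic).

Since the zero function is analytic, this also shows that such a polynomial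
expression is nonzero and, applied to the difference of two variables, that
distinct sequences give distinct generators; so there are continuum many. *)

(** * Sequences of successive derivatives *)

(** Carrying the derivatives as an explicit sequence of functions lets the
closed formulas for them be proved at the same time as differentiability. *)
Definition jet (R : realType) (u : nat -> R -> R) : Prop :=
  forall (n : nat) (x : R), is_derive x 1 (u n) (u n.+1 x).

Section jets.
Context {R : realType}.
Implicit Types (u v : nat -> R -> R) (f g : R -> R) (x : R).

Lemma is_derive_derive1 f g : (forall x, is_derive x 1 f (g x)) -> derive1 f = g.
Proof. by move=> fg; apply/funext => x; rewrite derive1E; apply: derive_val. Qed.

Lemma jet_derive1n {u} (n : nat) : jet u -> derive1n n (u 0%N) = u n.
Proof.
by move=> ju; elim: n => // n IH; rewrite /derive1n iterS -/(derive1n n _) IH;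
  apply: is_derive_derive1.
Qed.

Lemma jet_smooth {u} : jet u -> smooth (u 0%N).
Proof. by move=> ju n x; rewrite jet_derive1n//; apply: ex_derive. Qed.

Lemma is_derive_bigsum {T : Type} (s : seq T) (F : T -> R -> R) (dF : T -> R) x :
  (forall t, is_derive x 1 (F t) (dF t)) ->
  is_derive x 1 (fun y => \sum_(t <- s) F t y) (\sum_(t <- s) dF t).
Proof.
move=> FdF; elim: s => [|t s IH].
  rewrite big_nil (_ : (fun _ => _) = cst 0) ?funeqE//.
    by apply: is_derive_cst.
  by move=> y; rewrite big_nil.
rewrite big_cons (_ : (fun _ => _) = F t + (fun y => \sum_(t <- s) F t y)).
  exact: is_deriveD.
by apply/funext => y; rewrite big_cons.
Qed.

Lemma is_derive_scale (c : R) f x d :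
  is_derive x 1 f d -> is_derive x 1 (fun y => c * f y) (c * d).
Proof.
by move=> fd; rewrite (_ : (fun _ => _) = c \*: f)//; exact: is_deriveZ.
Qed.

Lemma jet_linear_combination {T : Type} (s : seq T) (c : T -> R)
    (u : T -> nat -> R -> R) : (forall t, jet (u t)) ->
  jet (fun n x => \sum_(t <- s) c t * u t n x).
Proof.
by move=> ju n x; apply: is_derive_bigsum => t; apply: is_derive_scale; apply: ju.
Qed.

(** The hypotheses stop at order n because derive1n_expR applies the rule, inside
an induction, to a function whose higher derivatives are not yet known to
exist. *)
Lemma leibniz {u v} n x :
    (forall j, (j <= n)%N -> is_derive x 1 (u j) (u j.+1 x)) ->
    (forall j, (j <= n)%N -> is_derive x 1 (v j) (v j.+1 x)) ->
  is_derive x 1 (fun y => \sum_(j < n.+1) 'C(n, j)%:R * (u j y * v (n - j)%N y))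
                (\sum_(j < n.+2) 'C(n.+1, j)%:R * (u j x * v (n.+1 - j)%N x)).
Proof.
move=> du dv.
have -> : \sum_(j < n.+2) 'C(n.+1, j)%:R * (u j x * v (n.+1 - j)%N x) =
    \sum_(j < n.+1) 'C(n, j)%:R *
       (u j x * v (n - j).+1 x + v (n - j)%N x * u j.+1 x).
  under [RHS]eq_bigr do rewrite mulrDr.
  rewrite big_split/= big_ord_recl /= bin0 subn0.
  under eq_bigr do rewrite /bump/= add1n subSS binS natrD mulrDl.
  rewrite big_split/= addrA; congr (_ + _); last first.
    by apply: eq_bigr => i _; congr (_ * _); rewrite mulrC.
  rewrite big_ord_recr/= (bin_small (ltnSn n)) mul0r addr0.
  rewrite [RHS]big_ord_recl/= bin0 subn0; congr (_ + _).
  by apply: eq_bigr => i _; rewrite /bump/= add1n subnSK.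
apply: is_derive_bigsum => j.
apply: is_derive_scale.
have jn : (j <= n)%N by rewrite -ltnS.
have := is_deriveM (du j jn) (dv (n - j)%N (leq_subr _ _)).
exact.
Qed.

(** The identity (exp F)' = F' exp F determines the derivatives of exp F by
recursion: differentiating it n times expresses the derivative of order n + 1
by those of order at most n. *)
Lemma derive1n_expR {F : nat -> R -> R} : jet F ->
  let h n := derive1n n (fun x => expR (F 0%N x)) in
  jet h /\ forall n x,
    h n.+1 x = \sum_(j < n.+1) 'C(n, j)%:R * (F j.+1 x * h (n - j)%N x).
Proof.
move=> jF h.
pose L n x := \sum_(j < n.+1) 'C(n, j)%:R * (F j.+1 x * h (n - j)%N x).
suff dh n x : is_derive x 1 (h n) (L n x).
  have hS n : h n.+1 = L n by exact: is_derive_derive1.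
  by split=> n x; rewrite hS.
elim/ltn_ind: n x => -[_ x|n IH x].
  rewrite /L big_ord_recl big_ord0 /= bin0 mul1r addr0 /h/=.
  have /= := is_derive1_comp (f := expR) (g := F 0%N) (is_derive_expR _) (jF 0%N x).
  by move=> /is_derive_eq; apply; rewrite mulrC.
have hS j : (j <= n)%N -> h j.+1 = L j.
  by move=> jn; apply: is_derive_derive1 => y; apply: IH.
rewrite hS//; apply: (@leibniz (fun j => F j.+1) h) => j jn; first exact: jF.
by rewrite hS//; apply: IH.
Qed.

(** Here a and h stand for the derivatives of F and of exp F at a point.  By
induction on m <= n, |h m| <= h 0 * m! * B ^ m: each of the m + 1 terms of the
recursion is at most m! B ^ (m + 1) h 0, as C(m, j) (m - j)! <= m!.  In the
recursion for h (n + 1) the only term with an uncontrolled factor is the one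
for j = n, namely a (n + 1) * h 0. *)
Lemma jet_bound_expR {a h : nat -> R} {B : R} {n : nat} :
    1 <= B -> 0 <= h 0%N ->
    (forall j, (0 < j <= n)%N -> `|a j| <= B) ->
    (forall m, h m.+1 = \sum_(j < m.+1) 'C(m, j)%:R * (a j.+1 * h (m - j)%N)) ->
  `|h n.+1 - a n.+1 * h 0%N| <= h 0%N * ((n.+1)`!%:R * B ^+ n.+1).
Proof.
move=> B1 h0 aB hS.
have B0 : 0 <= B by rewrite (le_trans ler01).
have step m (p : nat) : (m <= n)%N -> (p <= m.+1)%N -> (p <= n)%N ->
    (forall j, (j <= m)%N -> `|h j| <= h 0%N * (j`!%:R * B ^+ j)) ->
    `|\sum_(j < p) 'C(m, j)%:R * (a j.+1 * h (m - j)%N)| <=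
    h 0%N * ((m.+1)`!%:R * B ^+ m.+1).
  move=> mn pm pn hB.
  apply: le_trans (ler_norm_sum _ _ _) _.
  apply: (@le_trans _ _ (\sum_(j < p) h 0%N * (m`!%:R * B ^+ m.+1))).
    apply: ler_sum => j _.
    have jm : (j <= m)%N by rewrite -ltnS (leq_trans (ltn_ord j)).
    rewrite !normrM normr_nat.
    apply: (@le_trans _ _ ('C(m, j)%:R * (B * (h 0%N * ((m - j)`!%:R * B ^+ (m - j)))))).
      rewrite ler_wpM2l// ler_pM// ?aB//=; last by rewrite hB// leq_subr.
      by rewrite (leq_trans (ltn_ord j)).
    rewrite [leLHS](_ : _ = h 0%N * (('C(m, j) * (m - j)`!)%:R * B ^+ (m - j).+1)); last first.
      by rewrite natrM exprS; ring.
    rewrite ler_wpM2l// ler_pM// ?exprn_ge0//.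
      rewrite ler_nat -(bin_fact jm) leq_pmul2l ?bin_gt0//.
      by rewrite leq_pmull// fact_gt0.
    by rewrite ler_weXn2l// ltnS leq_subr.
  rewrite sumr_const card_ord -[leLHS]mulr_natl mulrCA ler_wpM2l// factS natrM -mulrA.
  by apply: ler_wpM2r; rewrite ?ler_nat// mulr_ge0// exprn_ge0.
have hB j : (j <= n)%N -> `|h j| <= h 0%N * (j`!%:R * B ^+ j).
  elim/ltn_ind: j => -[_ _|j IH jn]; first by rewrite fact0 expr0 !mulr1 ger0_norm.
  rewrite hS; apply: step => //; first exact: ltnW.
  by move=> i ij; apply: IH => //; rewrite (leq_trans ij)// ltnW.
by rewrite hS big_ord_recr/= subnn binn mul1r addrK; apply: step.
Qed.

End jets.

(** * Growth of the derivatives of an analytic function *)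

Section series_bounds.
Context {R : realType}.
Implicit Types (t A : nat -> R).

Lemma dominated_series_normed_cvg t A : (forall k, `|t k| <= A k) ->
  cvgn (series A) -> cvgn [normed series t].
Proof.
move=> tA cA; apply: (series_le_cvg _ _ _ cA) => k /=; [exact: normr_ge0| |exact: tA].
exact: le_trans (normr_ge0 _) (tA k).
Qed.

Lemma dominated_series_cvg t A : (forall k, `|t k| <= A k) ->
  cvgn (series A) -> cvgn (series t).
Proof.
by move=> tA cA; apply/normed_cvg/dominated_series_normed_cvg; [exact: tA|exact: cA].
Qed.

Lemma dominated_series_le t A (M : R) : (forall k, `|t k| <= A k) ->
  cvgn (series A) -> (forall n, series A n <= M) -> `|limn (series t)| <= M.
Proof.
move=> tA cA AM; have cn := dominated_series_normed_cvg tA cA.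
apply: le_trans (lim_series_norm cn) _; apply: limr_le => //.
by apply: nearW => n; apply: le_trans (AM n); apply: ler_sum => k _; apply: tA.
Qed.

Lemma geometric_half_series_le (C : R) n : 0 <= C ->
  series (fun k => C * 2^-1 ^+ k) n <= C * 2.
Proof.
move=> C0; rewrite seriesEnat/= -mulr_sumr ler_wpM2l//.
have -> : \sum_(0 <= k < n) (2^-1 : R) ^+ k = 2 - 2 * 2^-1 ^+ n.
  elim: n => [|n IH]; first by rewrite big_nil expr0 mulr1 subrr.
  by rewrite big_nat_recr//= IH exprS mulrA divff// mul1r; lra.
by rewrite gerBl mulr_ge0// exprn_ge0// invr_ge0.
Qed.

Lemma cvg_geometric_half (C : R) : cvgn (series (fun k => C * 2^-1 ^+ k)).
Proof.
by apply: is_cvg_geometric_series; rewrite ger0_norm ?invr_ge0// invf_lt1// ltr1n.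
Qed.

End series_bounds.

Section analytic.
Context {R : realType}.
Implicit Types (u : nat -> R -> R) (x : R) (a : nat -> R).

(** Iterating pseries_diffs n times gives the coefficients of the n-th
derivative; multiplying by k! avoids any division. *)
Lemma iter_pseries_diffsE a n k :
  iter n (@pseries_diffs R) a k * k`!%:R = a (n + k)%N * (n + k)`!%:R.
Proof.
elim: n k => // n IH k.
by rewrite iterS {1}/pseries_diffs mulrAC -natrM -factS mulrC IH addnS addSn.
Qed.

(** The factor (n + k)! / k! is n! C(n + k, n), and C(n + k, n) <= 2 ^ (n + k). *)
Lemma iter_pseries_diffs_le a (A s : R) n k : 0 <= A -> 0 <= s ->
  (forall k, `|a k| <= A * s ^+ k) ->
  `|iter n (@pseries_diffs R) a k| <= A * n`!%:R * (2 * s) ^+ (n + k).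
Proof.
move=> A0 s0 aA.
have kf : 0 < k`!%:R :> R by rewrite ltr0n fact_gt0.
rewrite -(ler_pM2r kf) -{1}(ger0_norm (ltW kf)) -normrM iter_pseries_diffsE.
rewrite normrM normr_nat.
apply: (@le_trans _ _ (A * s ^+ (n + k) * (n + k)`!%:R)); first by rewrite ler_wpM2r.
have -> : (n + k)`! = ('C(n + k, n) * (n`! * k`!))%N.
  by rewrite -(bin_fact (leq_addr k n)) addKn.
rewrite [leRHS](_ : _ = A * s ^+ (n + k) * ((2 ^ (n + k))%N * (n`! * k`!))%:R); last first.
  by rewrite exprMn !natrM natrX; ring.
apply: ler_wpM2l; first by rewrite mulr_ge0// exprn_ge0.
rewrite ler_nat leq_pmul2r ?muln_gt0 ?fact_gt0//.
rewrite -[(2 ^ _)%N]/((1 + 1) ^ (n + k))%N expnDn.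
have nk : (n < (n + k).+1)%N by rewrite ltnS leq_addr.
rewrite (bigD1 (Ordinal nk))//= !exp1n !muln1.
exact: leq_addr.
Qed.

Lemma near_dist_lt (x x0 d : R) : `|x - x0| < d -> \forall y \near x, `|y - x0| < d.
Proof.
move=> xd; apply/nbhs_ballP; exists (d - `|x - x0|) => /=; first by rewrite subr_gt0.
move=> y; rewrite /ball/= distrC ltrBrDr; apply: le_lt_trans.
by rewrite -[y - x0](subrKA x) ler_normD.
Qed.

(** The coefficients are O(rho ^ -k) for a radius rho inside the neighbourhood
of convergence.  On the smaller ball of radius rho / 4, the k-th term of the
n times differentiated series is then at most A n! (2 / rho) ^ n 2 ^ -k. *)
Lemma analytic_jet_bound u x0 : jet u -> analytic_at (u 0%N) x0 ->
  exists d C r : R, [/\ 0 < d, 0 <= C, 0 <= r &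
    forall x, `|x - x0| < d -> forall n, `|u n x| <= C * (n`!%:R * r ^+ n)].
Proof.
move=> ju [a /nbhs_ballP[e /= e0 ea]].
pose rho := e / 2.
have rho0 : 0 < rho by rewrite divr_gt0.
have [A A0 aA] : exists2 A : R, 0 <= A & forall k, `|a k| <= A * rho^-1 ^+ k.
  have /ea /cvgP /cvg_series_bounded [M [Mr HM]] : ball x0 e (x0 + rho).
    by rewrite /ball/= opprD addNKr normrN gtr0_norm// /rho; lra.
  exists (`|M| + 1) => [|k]; first by rewrite addr_ge0.
  have MM : M < `|M| + 1 by rewrite (le_lt_trans (ler_norm M))// ltrDl.
  have /= := HM _ MM k Logic.I.
  rewrite addrAC subrr add0r normrM [X in _ * X]ger0_norm ?exprn_ge0 ?(ltW rho0)// => H.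
  by rewrite exprVn -ler_pdivrMr ?invr_gt0 ?exprn_gt0// invrK.
pose s := 2 * rho^-1; pose K := rho / 4.
have s0 : 0 < s by rewrite mulr_gt0// invr_gt0.
have sK : s * K = 2^-1 by rewrite /s /K; field; rewrite gt_eqF.
have K0 : 0 < K by rewrite divr_gt0.
pose c n := iter n (@pseries_diffs R) a.
have cb n y : `|y| <= K -> forall k,
    `|c n k * y ^+ k| <= (A * n`!%:R * s ^+ n) * 2^-1 ^+ k.
  move=> yK k; rewrite normrM.
  have := @iter_pseries_diffs_le a A rho^-1 n k A0 _ aA.
  rewrite invr_ge0 => /(_ (ltW rho0)).
  rewrite exprD mulrA -/s => ck; rewrite -sK (exprMn k s) [leRHS]mulrA.
  by rewrite ler_pM// normrX lerXn2r// nnegrE// (ltW K0).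
have cc n y : `|y| <= K -> cvgn (pseries (c n) y).
  move=> yK; apply: dominated_series_cvg (cb n y yK) _; exact: cvg_geometric_half.
have uE n x : `|x - x0| < K -> u n x = limn (pseries (c n) (x - x0)).
  elim: n x => [|n IH] x xK.
    apply/esym/cvg_lim => //; apply: ea; rewrite /ball/= distrC (lt_trans xK)//.
    by rewrite /K /rho; lra.
  have KK : `|K| <= K by rewrite ger0_norm// ltW.
  have dp : is_derive (x - x0) 1 (fun y => limn (pseries (c n) y))
      (limn (pseries (c n.+1) (x - x0))).
    apply: (@pseries_snd_diffs R (c n) K); [exact: cc|exact: (cc n.+1)|exact: (cc n.+2)|].
    by rewrite [`|K|]ger0_norm// ltW.
  have dq : is_derive x 1 (fun y : R => limn (pseries (c n) (y - x0)))
      (limn (pseries (c n.+1) (x - x0))).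
    have h : is_derive x 1 (fun y : R => y - x0) 1.
      by have := is_deriveB (is_derive_id x 1) (is_derive_cst x0 x 1); rewrite subr0.
    by have := is_derive1_comp (g := fun y : R => y - x0) dp h; rewrite mulr1.
  have /near_eq_is_derive : \near x, (fun y : R => limn (pseries (c n) (y - x0))) x = u n x.
    have := near_dist_lt xK.
    by apply: filterS => y yK; rewrite IH.
  move=> /(_ _ _ dq) du.
  by rewrite -(@derive_val _ _ _ _ _ _ _ du) (@derive_val _ _ _ _ _ _ _ (ju n x)).
exists K, (A * 2), s; split => //; [by rewrite mulr_ge0|exact: ltW|].
move=> x xK n; rewrite uE//.
rewrite [leRHS](_ : _ = A * n`!%:R * s ^+ n * 2); last by ring.
apply: (dominated_series_le (cb n _ (ltW xK)) (@cvg_geometric_half R _)) => k.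
by apply: geometric_half_series_le; rewrite !mulr_ge0// exprn_ge0// ltW.
Qed.

End analytic.

(** * Termwise differentiation of series *)

Section termwise.
Context {R : realType}.

(** A remainder that is quadratic in the increment can be summed termwise; this
makes it more convenient below than uniform convergence of the derivatives. *)
Lemma is_derive_quadratic_remainder (f : R -> R) (x d M : R) :
  (forall e, `|f (x + e) - f x - e * d| <= e ^+ 2 * M) -> is_derive x 1 f d.
Proof.
move=> fM.
have key : (fun e : R => e^-1 *: ((f \o shift x) (e *: 1) - f x)) @ 0^' --> d.
  have : (fun e : R => e^-1 * (f (x + e) - f x) - d) @ 0^' --> 0.
    apply: (@cvg_to_0_linear _ _ M 1) => // e /andP[e0 _].
    rewrite normr_gt0 in e0.
    rewrite [X in `|X|](_ : _ = e^-1 * (f (x + e) - f x - e * d)); last first.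
      by rewrite [RHS]mulrBr mulrA mulVf// mul1r.
    rewrite normrM normfV ler_pdivrMl ?normr_gt0// (le_trans (fM e))//.
    by rewrite mulrCA -expr2 real_normK ?num_real// mulrC.
  move=> h.
  have := cvgD h (cvg_cst d).
  rewrite add0r (_ : _ + _ = fun e : R => e^-1 *: ((f \o shift x) (e *: 1) - f x)).
    exact.
  by apply/funext => e; rewrite fctE/= subrK scaler1 [e + x]addrC.
apply: DeriveDef; first by apply/cvg_ex; exists d.
exact/cvg_lim.
Qed.

Lemma is_derive_series (t t' : nat -> R -> R) (A : nat -> R) (x : R) :
    (forall y, cvgn (series (fun k => t k y))) ->
    cvgn (series (fun k => t' k x)) -> cvgn (series A) ->
    (forall k e, `|t k (x + e) - t k x - e * t' k x| <= e ^+ 2 * A k) ->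
  is_derive x 1 (fun y => limn (series (fun k => t k y)))
                (limn (series (fun k => t' k x))).
Proof.
move=> ct ct' cA tA; apply: (@is_derive_quadratic_remainder _ _ _ (limn (series A))) => e.
pose r k := t k (x + e) - t k x - e * t' k x.
have cZ (c : R) (a : nat -> R) : cvgn (series a) -> 
    series (fun k => c * a k) @ \oo --> c * limn (series a).
  move=> ca; have -> : series (fun k => c * a k) = (fun n => c * series a n).
    by apply/funext => n; rewrite /series/= mulr_sumr.
  exact: cvgMr.
have cr : series r @ \oo --> limn (series (fun k => t k (x + e))) -
    limn (series (fun k => t k x)) - e * limn (series (fun k => t' k x)).
  have -> : series r = (fun n => series (fun k => t k (x + e)) n -
      series (fun k => t k x) n - series (fun k => e * t' k x) n).
    by apply/funext => n; rewrite /series/= /r !sumrB.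
  by apply: cvgB; [apply: cvgB; [exact: ct|exact: ct]|exact: cZ].
rewrite -(cvg_lim _ cr)//.
have cA' := cZ (e ^+ 2) _ cA.
apply: (@dominated_series_le _ _ (fun k => e ^+ 2 * A k)).
- by move=> k; apply: tA.
- by apply: cvgP cA'.
move=> n; have : series A n <= limn (series A).
  apply: nondecreasing_cvgn_le => //; apply: nondecreasing_series => k _ _.
  by have := le_trans (normr_ge0 _) (tA k 1); rewrite expr1n mul1r.
have -> : series (fun k => e ^+ 2 * A k) n = e ^+ 2 * series A n.
  by rewrite /series/= mulr_sumr.
by move=> ?; rewrite ler_wpM2l// sqr_ge0.
Qed.

(** Increments of both signs occur, so a and b come in either order. *)
Lemma mean_value (f g : R -> R) (a b : R) : (forall x : R, is_derive x 1 f (g x)) ->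
  exists2 c, `|c - a| <= `|b - a| & f b - f a = g c * (b - a).
Proof.
move=> fg.
have fc (x y : R) : {within `[x, y], continuous f}.
  apply: continuous_subspaceT => z.
  by apply/differentiable_continuous/derivable1_diffP; apply: ex_derive.
have [ab|ba] := leP a b.
  have [c + ->] := MVT_segment ab (fun x _ => fg x) (fc a b).
  rewrite in_itv/= => /andP[ac cb]; exists c => //.
  by rewrite !ger0_norm ?subr_ge0// lerD2r.
have [c + E] := MVT_segment (ltW ba) (fun x _ => fg x) (fc b a).
rewrite in_itv/= => /andP[bc ca]; exists c.
  by rewrite !ler0_norm ?subr_le0 ?(ltW ba)// lerN2 lerD2r.
by rewrite -opprB E -mulrN opprB.
Qed.

Lemma cos_quadratic_remainder (y e : R) :
  `|cos (y + e) - cos y + e * sin y| <= e ^+ 2.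
Proof.
have [c cy ->] := @mean_value cos (fun x => - sin x) y (y + e) (@is_derive_cos R).
have [d dy E] := @mean_value sin cos y c (@is_derive_sin R).
have -> : y + e - y = e by rewrite addrAC subrr add0r.
rewrite [X in `|X|](_ : _ = - (e * (sin c - sin y))); last by ring.
rewrite addrAC subrr add0r in cy.
rewrite E normrN !normrM -[e ^+ 2]real_normK ?num_real// expr2.
rewrite ler_wpM2l// -[leRHS]mul1r ler_pM//; exact: cos_max.
Qed.

End termwise.

(** * An almost disjoint family of sets of integers *)

(** The integers that code a finite prefix of b. *)
Definition prefix_code (b : continuum) (k : nat) : bool :=
  if (unpickle k : option (seq bool)) is Some s then s == mkseq b (size s) else false.

Lemma prefix_codeP (b : continuum) (s : seq bool) :
  prefix_code b (pickle s) = (s == mkseq b (size s)).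
Proof. by rewrite /prefix_code pickleK. Qed.

Lemma injective_unbounded (f : nat -> nat) (N L : nat) : injective f ->
  exists2 l, (L <= l)%N & (N <= f l)%N.
Proof.
move=> finj; apply: contrapT => H.
have fN (i : nat) : (f (L + i) < N)%N.
  by rewrite ltnNge; apply/negP => Nf; apply: H; exists (L + i)%N => //; exact: leq_addr.
pose g (i : 'I_N.+1) : 'I_N := Ordinal (fN i).
have ginj : injective g.
  by move=> i j [/finj /addnI ij]; apply: val_inj.
by have := leq_card g ginj; rewrite !card_ord ltnn.
Qed.

(** A prefix of b i0 that is long enough to differ from all the other b i has a
code with the required property, and there are infinitely many of them. *)
Lemma prefix_code_separation n (b : 'I_n -> continuum) (i0 : 'I_n) (N : nat) :
  injective b -> exists k, [/\ (N <= k)%N, prefix_code (b i0) k &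
    forall i, i != i0 -> ~~ prefix_code (b i) k].
Proof.
move=> binj.
have /choice[p pP] i : exists p, i != i0 -> b i p != b i0 p.
  have [->|ii0] := eqVneq i i0; first by exists 0%N.
  apply: contrapT => H; move/eqP: ii0; apply; apply: binj; apply/funext => p.
  by apply: contrapT => /eqP bp; apply: H; exists p.
(* Every b i with i != i0 differs from b i0 at the position p i < L. *)
pose L := (\max_i p i).+1.
have cinj : injective (fun l => pickle (mkseq (b i0) l)).
  by move=> l l' /(pcan_inj pickleK)/(congr1 size); rewrite !size_mkseq.
have [l Ll Nl] := injective_unbounded N L cinj.
exists (pickle (mkseq (b i0) l)); split => //.
  by rewrite prefix_codeP size_mkseq.
move=> i ii0; rewrite prefix_codeP size_mkseq; apply/negP => /eqP E.
have pl : (p i < l)%N by apply: leq_trans Ll; rewrite ltnS leq_bigmax.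
have := congr1 (fun s => nth false s (p i)) E; rewrite !nth_mkseq//.
by move/eqP; rewrite eq_sym; apply/negP; apply: pP.
Qed.

(** * Superlacunary series *)

(** Size that the k-th peak must reach when M bounds the background: n! (n M) ^ n
with n = k + 1, plus M for what the other waves may subtract from it. *)
Definition spike (k M : nat) : nat := (k.+1)`! * (k.+1 * M) ^ k.+1 + M.

(** The frequencies lam_k.  The inequality t < 2 ^ t makes lam_k at least as
large as the exponent, hence as the spike; the summand k of the exponent makes
2 ^ m divide lam_k for all k >= m, so that the waves are eventually all in phase
at the points of the dense set dyadic_circle. *)
Fixpoint freq (k : nat) : nat :=
  let c := if k is k'.+1 then freq k' else 0 in
  2 ^ (spike k (4 + k * c ^ k.+1) + k).

(** With n = k + 1: the k waves before the k-th one contribute at most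
lam_(k-1) ^ n each to a derivative of order at most n; the later ones, and the
k-th one itself for orders below n, are dominated by a geometric series of
sum 4. *)
Definition background (k : nat) : nat := 4 + k * freq k.-1 ^ k.+1.

Arguments freq : simpl never.

Lemma freqE k : freq k = (2 ^ (spike k (background k) + k))%N.
Proof. by case: k. Qed.

Lemma spike_le_freq k : (spike k (background k) <= freq k)%N.
Proof. by rewrite freqE (leq_trans _ (ltnW (ltn_expl _ _)))// leq_addr. Qed.

Lemma dvdn_freq m k : (m <= k)%N -> (2 ^ m %| freq k)%N.
Proof. by move=> mk; rewrite freqE dvdn_exp2l// (leq_trans mk)// leq_addl. Qed.

Lemma freq_ge2 k : (2 <= freq k)%N.
Proof.
apply: leq_trans (spike_le_freq k); rewrite /spike /background.
by rewrite (leq_trans _ (leq_addl _ _))// (leq_trans _ (leq_addr _ _)).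
Qed.

Lemma freq_homo : {homo freq : k l / (k <= l)%N}.
Proof.
apply: homo_leq => [x|y x z|k]; [exact: leqnn|exact: leq_trans|].
apply: leq_trans (spike_le_freq k.+1).
rewrite /spike (leq_trans _ (leq_addl _ _))// /background (leq_trans _ (leq_addl _ _))//=.
by rewrite mulSn (leq_trans _ (leq_addr _ _))// expnS leq_pmulr// expn_gt0 (ltnW (freq_ge2 k)).
Qed.

Section lacunary.
Context {R : realType}.

Definition amplitude (n k : nat) : R := (freq k)%:R ^+ n / (freq k)%:R ^+ k.

Let freq_gt0 k : 0 < (freq k)%:R :> R.
Proof. by rewrite ltr0n (leq_trans _ (freq_ge2 k)). Qed.

Let freq_ge1 k : 1 <= (freq k)%:R :> R.
Proof. by rewrite ler1n (leq_trans _ (freq_ge2 k)). Qed.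

Lemma amplitude_ge0 n k : 0 <= amplitude n k.
Proof. by rewrite divr_ge0// exprn_ge0. Qed.

Lemma amplitudeS n k : amplitude n.+1 k = (freq k)%:R * amplitude n k.
Proof. by rewrite /amplitude exprS mulrA. Qed.

(** From the wave of index n on, the n-th derivative still gains the negative
power lam_k ^ (n - k). *)
Lemma amplitude_high n k : (n <= k)%N -> amplitude n k <= 2^-1 ^+ (k - n).
Proof.
move=> nk; rewrite /amplitude -[X in _ / _ ^+ X](subnKC nk) exprD invfM mulrA.
rewrite divff ?mul1r; last first.
  by rewrite expf_neq0// gt_eqF.
rewrite -exprVn lerXn2r// ?nnegrE ?invr_ge0//.
by rewrite lef_pV2 ?posrE// ler_nat freq_ge2.
Qed.

Lemma amplitude_low n k : amplitude n k <= (freq k)%:R ^+ n.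
Proof. by rewrite ler_pdivrMr ?exprn_gt0// ler_peMr ?exprn_ge0// exprn_ege1. Qed.

Lemma cvg_amplitude n : cvgn (series (amplitude n)).
Proof.
apply: (@dominated_series_cvg _ _ (fun k => ((freq n)%:R * 2) ^+ n * 2^-1 ^+ k)); last first.
  exact: cvg_geometric_half.
move=> k; rewrite ger0_norm ?amplitude_ge0// exprMn -mulrA.
have [nk|kn] := leqP n k.
  apply: le_trans (amplitude_high nk) _.
  rewrite -[X in _ * (_ * _ ^+ X)](subnKC nk) exprD [X in _ * X]mulrA -exprMn divff// expr1n mul1r.
  by rewrite ler_peMl ?exprn_ge0 ?invr_ge0// exprn_ege1.
apply: le_trans (amplitude_low n k) _; rewrite -[leLHS]mulr1 ler_pM ?exprn_ge0//.
  by rewrite lerXn2r ?nnegrE// ler_nat freq_homo// ltnW.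
rewrite -[X in 2 ^+ X](subnK (ltnW kn)) exprD -mulrA -exprMn divff// expr1n mulr1.
by rewrite exprn_ege1// ler1n.
Qed.

(** A common bound for the amplitudes that make up the background. *)
Let majorant (k l : nat) : R :=
  if (l < k)%N then (freq k.-1)%:R ^+ k.+1 else 2 * 2^-1 ^+ (l - k).

Let majorant_ge0 k l : 0 <= majorant k l.
Proof. by rewrite /majorant; case: ifP => _; rewrite ?mulr_ge0 ?exprn_ge0 ?invr_ge0. Qed.

Let majorant_series_le k n : series (majorant k) n <= (background k)%:R.
Proof.
set c : R := (freq k.-1)%:R ^+ k.+1.
have c0 : 0 <= c by rewrite exprn_ge0.
have -> : series (majorant k) n = (minn n k)%:R * c + (4 - 4 * 2^-1 ^+ (n - k)).
  elim: n => [|n IH]; first by rewrite seriesEnat/= big_nil min0n sub0n; ring.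
  rewrite seriesSr IH /majorant; have [nk|kn] := ltnP n k.
    rewrite (minn_idPl nk).
    rewrite (eqP (nk : (n.+1 - k == 0)%N)) (eqP (ltnW nk : (n - k == 0)%N)) -/c.
    by rewrite -natr1; ring.
  rewrite (minn_idPr (leqW kn)) subSn// exprS.
  by field.
rewrite /background natrD natrM natrX -/c addrC lerD//.
  by rewrite gerBl mulr_ge0// exprn_ge0// invr_ge0.
by rewrite ler_wpM2r// ler_nat geq_minr.
Qed.

Let cvg_majorant k : cvgn (series (majorant k)).
Proof.
apply: nondecreasing_is_cvgn; first by apply: nondecreasing_series.
by exists (background k)%:R => _ [n _ <-].
Qed.

(** In the derivative of order k + 1 the k-th amplitude is lam_k itself, the
only one that is not part of the background. *)
Let amplitude_majorant j k l : (j <= k.+1)%N -> (j == k.+1) ==> (l != k) ->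
  amplitude j l <= majorant k l.
Proof.
move=> jk jl; rewrite /majorant; have [lk|kl] := ltnP l k.
  apply: le_trans (amplitude_low _ _) _.
  apply: (@le_trans _ _ ((freq k.-1)%:R ^+ j)); last by rewrite ler_weXn2l.
  by rewrite lerXn2r ?nnegrE// ler_nat freq_homo// -ltnS (leq_trans lk)// leqSpred.
have lj : (j <= l)%N.
  move: jk; rewrite leq_eqVlt => /orP[jk|]; last by rewrite ltnS => /leq_trans; apply.
  by rewrite (eqP jk) ltn_neqAle kl andbT eq_sym (implyP jl).
apply: le_trans (amplitude_high lj) _.
have -> : (2 : R) * 2^-1 ^+ (l - k) = 2^-1 ^+ (l - k) / 2^-1 by rewrite invrK mulrC.
rewrite ler_pdivlMr ?invr_gt0// -exprSr.
rewrite ler_wiXn2l ?invr_ge0// ?invf_le1// ?ler1n//.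
by rewrite -subSn// -(subSS k) leq_sub2l.
Qed.

(** The n-th derivative of the k-th wave: differentiating multiplies the
amplitude by lam_k and advances the phase by pi / 2.  The phase is normalised to
vanish for n = k + 1, where the k-th wave has to peak. *)
Definition wave (b : continuum) (n k : nat) (x : R) : R :=
  (prefix_code b k)%:R * amplitude n k *
    cos ((freq k)%:R * x + (n%:R - k.+1%:R) * (pi / 2)).

Definition lacunary (b : continuum) (n : nat) (x : R) : R :=
  limn (series (fun k => wave b n k x)).

Lemma wave_le b n k x : `|wave b n k x| <= (prefix_code b k)%:R * amplitude n k.
Proof.
rewrite /wave normrM [X in X * _]ger0_norm ?mulr_ge0 ?amplitude_ge0//.
by rewrite ler_piMr ?mulr_ge0 ?amplitude_ge0// cos_max.
Qed.

Lemma wave_le_amplitude b n k x : `|wave b n k x| <= amplitude n k.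
Proof.
apply: le_trans (wave_le b n k x) _.
by rewrite ler_piMl ?amplitude_ge0// lern1 leq_b1.
Qed.

Lemma cvg_wave b n x : cvgn (series (fun k => wave b n k x)).
Proof.
apply: (@dominated_series_cvg _ _ (amplitude n)); last exact: cvg_amplitude.
by move=> k; apply: wave_le_amplitude.
Qed.

Lemma jet_lacunary b : jet (lacunary b).
Proof.
move=> n x; apply: (@is_derive_series _ _ _ (amplitude n.+2)).
- by move=> y; apply: cvg_wave.
- exact: cvg_wave.
- exact: cvg_amplitude.
move=> k e; rewrite /wave !amplitudeS.
set f := (freq k)%:R; set p := (_)%:R; set A := amplitude n k.
set y := f * x + (n%:R - k.+1%:R) * (pi / 2).
have -> : f * (x + e) + (n%:R - k.+1%:R) * (pi / 2) = y + f * e by rewrite /y; ring.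
have -> : f * x + (n.+1%:R - k.+1%:R) * (pi / 2) = y + pi / 2.
  by rewrite /y -[n.+1%:R]natr1; ring.
rewrite cosDpihalf.
rewrite [X in `|X|](_ : _ = p * A * (cos (y + f * e) - cos y + f * e * sin y)); last by ring.
have pA : 0 <= p * A by rewrite mulr_ge0 ?amplitude_ge0// /p.
rewrite normrM (ger0_norm pA).
apply: le_trans (ler_wpM2l pA (cos_quadratic_remainder _ _)) _.
rewrite [leLHS](_ : _ = p * (e ^+ 2 * (f * (f * A)))); last by ring.
by rewrite ler_piMl ?lern1 ?leq_b1// mulr_ge0 ?sqr_ge0// !mulr_ge0 ?amplitude_ge0.
Qed.

(** For orders at most k all the waves belong to the background. *)
Lemma lacunary_lower_derivative b j k x : (j <= k)%N ->
  `|lacunary b j x| <= (background k)%:R.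
Proof.
move=> jk; apply: (@dominated_series_le _ _ (majorant k)) => // l.
apply: le_trans (wave_le_amplitude _ _ _ _) _.
by apply: amplitude_majorant; rewrite ?leqW// (ltn_eqF (jk : (j < k.+1)%N)).
Qed.

(** When the k-th wave is absent, only background is left in the derivative of
order k + 1. *)
Lemma lacunary_silent b k x : ~~ prefix_code b k ->
  `|lacunary b k.+1 x| <= (background k)%:R.
Proof.
move=> bk; apply: (@dominated_series_le _ _ (majorant k)) => // l.
apply: le_trans (wave_le _ _ _ _) _.
have [->|lk] := eqVneq l k; first by rewrite (negbTE bk) mul0r.
apply: (@le_trans _ _ (amplitude k.+1 l)).
  by rewrite ler_piMl ?amplitude_ge0// lern1 leq_b1.
by apply: amplitude_majorant; rewrite ?lk ?implybT.
Qed.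

Definition dyadic_circle : set R :=
  [set x | exists m (j : int), x = pi *+ 2 * j%:~R / 2 ^+ m].

Lemma dyadic_circle_dense (x e : R) : 0 < e ->
  exists2 y, dyadic_circle y & `|y - x| < e.
Proof.
move=> e0; have p0 : 0 < pi *+ 2 :> R by rewrite mulrn_wgt0// pi_gt0.
pose m := Num.truncn (pi *+ 2 / e).
have m0 : 0 < 2 ^+ m :> R by rewrite exprn_gt0.
have hm : pi *+ 2 / 2 ^+ m < e.
  rewrite ltr_pdivrMr// mulrC -ltr_pdivrMr//.
  rewrite (lt_le_trans (truncnS_gt _))// -natrX ler_nat.
  exact: ltn_expl.
pose j := Num.floor (x * 2 ^+ m / (pi *+ 2)).
exists (pi *+ 2 * j%:~R / 2 ^+ m); first by exists m, j.
have h1 : pi *+ 2 * j%:~R / 2 ^+ m <= x.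
  rewrite ler_pdivrMr// mulrC -ler_pdivlMr//; exact: floor_le.
have h2 : x < pi *+ 2 * j%:~R / 2 ^+ m + pi *+ 2 / 2 ^+ m.
  rewrite -mulrDl -[X in _ + X]mulr1 -mulrDr ltr_pdivlMr// -ltr_pdivrMl// mulrC.
  by rewrite -intrD1; exact: floorD1_gt.
by rewrite distrC ger0_norm ?subr_ge0// ltrBlDl (lt_trans h2)// ltrD2l.
Qed.

Lemma cos_int_period (i : int) : cos (pi *+ 2 * i%:~R : R) = 1.
Proof.
have cosn (n : nat) : cos (pi *+ 2 * n%:R : R) = 1.
  by rewrite mulr_natr -[X in cos X]add0r (periodicn (@cosD2pi R)) cos0.
by case: i => n; rewrite ?NegzE ?mulrNz ?mulrN ?cosN -pmulrn cosn.
Qed.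

(** At a point 2 pi j / 2 ^ m, the k-th wave with k >= m, differentiated k + 1
times, is lam_k cos (lam_k x) = lam_k, as 2 ^ m divides lam_k. *)
Lemma lacunary_peak x : dyadic_circle x -> exists K : nat,
  forall (b : continuum) k, (K <= k)%N -> prefix_code b k ->
  (k.+1)`!%:R * (k.+1%:R * (background k)%:R) ^+ k.+1 <= lacunary b k.+1 x.
Proof.
move=> [m [j xE]]; exists m => b k mk bk.
apply: (@le_trans _ _ ((freq k)%:R - (background k)%:R)).
  rewrite lerBrDr -natrM -natrX -natrM -natrD ler_nat; exact: spike_le_freq.
apply: limr_ge; first exact: cvg_wave.
exists k.+1 => // n /= kn.
rewrite /series/= big_mkord (bigD1 (Ordinal kn))//=.
have -> : wave b k.+1 k x = (freq k)%:R.
  have /dvdnP[q qE] := dvdn_freq mk.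
  rewrite /wave bk subrr mul0r addr0 mul1r.
  have -> : (freq k)%:R * x = pi *+ 2 * (q%:Z * j)%:~R.
    by rewrite xE qE natrM natrX intrM -pmulrn; field.
  rewrite cos_int_period mulr1 /amplitude exprS mulfK//.
  by rewrite expf_neq0// gt_eqF.
rewrite lerD2l lerNl (le_trans (ler_norm _))// normrN.
apply: le_trans (ler_norm_sum _ _ _) _.
apply: (@le_trans _ _ (\sum_(l < n) majorant k l)); last first.
  by rewrite -(big_mkord xpredT (majorant k)); apply: majorant_series_le.
rewrite [leRHS](bigD1 (Ordinal kn))//= -[leLHS]add0r lerD//.
apply: ler_sum => l lk; apply: le_trans (wave_le_amplitude _ _ _ _) _.
by apply: amplitude_majorant; rewrite // eqxx.
Qed.

End lacunary.

(** * Finite sums of exponentials of lacunary series *)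

Lemma jet_zero_on_ball (R : realType) (u : nat -> R -> R) (x0 d : R) : jet u ->
  (forall x, `|x - x0| < d -> u 0%N x = 0) ->
  forall n x, `|x - x0| < d -> u n x = 0.
Proof.
move=> ju u0; elim=> [//|n IH] x xd.
have un0 : \near x, cst 0 x = u n x.
  by have := near_dist_lt xd; apply: filterS => y yd; rewrite IH.
have := near_eq_is_derive un0 (is_derive_cst (0 : R) x 1) => du.
by rewrite -(@derive_val _ _ _ _ _ _ _ (ju n x)) (@derive_val _ _ _ _ _ _ _ du).
Qed.

Lemma jet_continuous (R : realType) (u : nat -> R -> R) n : jet u -> continuous (u n).
Proof.
by move=> ju x; apply/differentiable_continuous/derivable1_diffP; apply: ex_derive.
Qed.

(** For d > 0, as soon as n >= 2 d, the hypothesis yields S 2 ^ n <= C. *)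
Lemma superexponential_unbounded (R : realType) (S C d : R) :
  0 <= S -> 0 <= C -> 0 <= d ->
  (forall N, exists2 n, (N <= n)%N & S * n%:R ^+ n <= C * d ^+ n) -> S = 0.
Proof.
move=> S0 C0 d0 H; apply/eqP; rewrite eq_le S0 andbT leNgt; apply/negP => Sp.
have [n + Hn] := H (maxn (Num.truncn (2 * d)).+1 (Num.truncn (C / S)).+1).
rewrite geq_max => /andP[n1 n2].
have dn : 2 * d <= n%:R.
  by rewrite (le_trans (ltW (truncnS_gt _)))// ler_nat.
have CS : C < S * n%:R.
  rewrite mulrC -ltr_pdivrMr//; rewrite (lt_le_trans (truncnS_gt _))// ler_nat//.
have dn1 : S * (2 * d) ^+ n <= C * d ^+ n.
  apply: le_trans Hn; rewrite ler_wpM2l// lerXn2r ?nnegrE//.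
  by rewrite mulr_ge0.
have n0 : 0 < n%:R :> R by rewrite ltr0n (leq_trans _ n1).
have [d00|dp] := eqVneq d 0.
  move: Hn; rewrite d00 expr0n; have -> : n == 0%N = false by rewrite gtn_eqF// (leq_trans _ n1).
  by rewrite mulr0 leNgt mulr_gt0// exprn_gt0.
have dpos : 0 < d by rewrite lt_neqAle eq_sym dp.
move: dn1; rewrite exprMn mulrA ler_pM2r ?exprn_gt0//; apply/negP; rewrite -ltNge.
apply: lt_le_trans CS _; rewrite ler_wpM2l// -natrX ler_nat; exact: ltnW (ltn_expl _ _).
Qed.

Section exponential_sums.
Context {R : realType} {nv : nat} (b : 'I_nv -> continuum) {T : eqType}
  (s : seq T) (e : T -> 'I_nv -> nat).
Implicit Types (w : T -> R) (x : R).

(** The exponent F_t, together with its derivatives. *)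
Definition phase (t : T) (n : nat) (x : R) : R :=
  \sum_i (e t i)%:R * lacunary (b i) n x.

Lemma jet_phase t : jet (phase t).
Proof. by apply: jet_linear_combination => i; apply: jet_lacunary. Qed.

(** The sum of the w_t exp F_t, together with its derivatives. *)
Definition expsum w (n : nat) (x : R) : R :=
  \sum_(t <- s) w t * derive1n n (fun y => expR (phase t 0 y)) x.

Lemma jet_expsum w : jet (expsum w).
Proof.
apply: (@jet_linear_combination R T s w
  (fun t n => derive1n n (fun y => expR (phase t 0 y)))) => t.
exact: (derive1n_expR (jet_phase t)).1.
Qed.

Hypothesis b_inj : injective b.

(** At a peak of f_(b i0), each exp F_t has (e t i0) * D * exp F_t as its n-th
derivative, where D is the n-th derivative of f_(b i0), up to an error of order
n! (d M) ^ n.  So D * sum_t w_t (e t i0) exp F_t is of order n! (d M) ^ n too,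
while D >= n! (n M) ^ n: dividing by n! M ^ n leaves n ^ n against d ^ n. *)
Lemma expsum_peak w (x C r : R) (i0 : 'I_nv) : dyadic_circle x -> 0 <= C -> 0 <= r ->
  (forall n, `|expsum w n x| <= C * (n`!%:R * r ^+ n)) ->
  expsum (fun t => w t * (e t i0)%:R) 0 x = 0.
Proof.
move=> /lacunary_peak[K peak] C0 r0 wC.
(* The constant d dominates r and all the degrees, so that d * M bounds the
   derivatives of order < n of every phase and r ^ n <= (d * M) ^ n. *)
pose d : R := 1 + r + \sum_(t <- s) \sum_i (e t i)%:R.
pose H : R := \sum_(t <- s) `|w t| * expR (phase t 0 x).
have sum0 (s' : seq T) : 0 <= \sum_(t <- s') \sum_i (e t i)%:R :> R.
  by apply: sumr_ge0 => t _; apply: sumr_ge0.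
have H0 : 0 <= H by apply: sumr_ge0 => t _; rewrite mulr_ge0// expR_ge0.
have d1 : 1 <= d by rewrite /d -addrA lerDl addr_ge0.
have d0 : 0 <= d by rewrite (le_trans ler01).
have rd : r <= d by rewrite /d addrAC lerDr addr_ge0.
have ed t : t \in s -> \sum_i (e t i)%:R <= d.
  move=> ts; rewrite /d (perm_big _ (perm_to_rem ts)) big_cons/= addrCA lerDl.
  by rewrite addr_ge0// addr_ge0.
set S := expsum _ 0 x.
apply/eqP; rewrite -normr_eq0; apply/eqP.
apply: (@superexponential_unbounded _ _ (C + 2 * H) d) => // [|N].
  by rewrite addr_ge0// mulr_ge0.
have [k [Nk bk obk]] := prefix_code_separation i0 (maxn N K) b_inj.
move: Nk; rewrite geq_max => /andP[Nk Kk].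
exists k.+1; first exact: leqW.
pose M : R := (background k)%:R; pose B := d * M.
have M1 : 1 <= M by rewrite ler1n.
have M0 : 0 < M by rewrite (lt_le_trans ltr01).
have B1 : 1 <= B by rewrite -[1]mulr1 ler_pM.
have B0 : 0 <= B by rewrite (le_trans ler01).
pose X : R := (k.+1)`!%:R * B ^+ k.+1.
have X0 : 0 <= X by rewrite mulr_ge0// exprn_ge0.
have BX : B <= X.
  rewrite -[B]mul1r ler_pM// ?ler1n ?fact_gt0//.
  by rewrite exprS ler_peMr// exprn_ege1.
pose D := lacunary (b i0) k.+1 x.
have hD : (k.+1)`!%:R * (k.+1%:R * M) ^+ k.+1 <= D by exact: peak.
have term t : t \in s ->
    `|derive1n k.+1 (fun y => expR (phase t 0 y)) x -
      (e t i0)%:R * D * expR (phase t 0 x)| <= 2 * (expR (phase t 0 x) * X).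
  move=> ts; have [_ hS] := derive1n_expR (jet_phase t).
  have phB j : (0 < j <= k)%N -> `|phase t j x| <= B.
    move=> /andP[_ jk]; apply: le_trans (ler_norm_sum _ _ _) _.
    apply: (@le_trans _ _ (\sum_i (e t i)%:R * M)).
      apply: ler_sum => i _; rewrite normrM normr_nat ler_wpM2l//.
      exact: lacunary_lower_derivative.
    by rewrite -mulr_suml ler_pM// ?ed// sumr_ge0.
  have h1 := jet_bound_expR (h := fun n => derive1n n (fun y => expR (phase t 0 y)) x)
    (a := fun j => phase t j x) B1 (expR_ge0 _) phB (fun m => hS m x).
  have h2 : `|phase t k.+1 x - (e t i0)%:R * D| <= B.
    rewrite /phase (bigD1 i0)//= addrAC subrr add0r.
    apply: le_trans (ler_norm_sum _ _ _) _.
    apply: (@le_trans _ _ (\sum_(i | i != i0) (e t i)%:R * M)).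
      apply: ler_sum => i ii0; rewrite normrM normr_nat ler_wpM2l//.
      by apply: lacunary_silent; apply: obk.
    rewrite -mulr_suml ler_pM// ?sumr_ge0//; apply: le_trans (ed t ts).
    by rewrite [leRHS](bigD1 i0)//= lerDr.
  set h := expR (phase t 0 x).
  have h0 : 0 <= h by exact: expR_ge0.
  rewrite [X in `|X|](_ : _ = (derive1n k.+1 (fun y => expR (phase t 0 y)) x -
      phase t k.+1 x * h) + (phase t k.+1 x - (e t i0)%:R * D) * h); last by ring.
  rewrite [leRHS]mulr_natl mulr2n; apply: le_trans (ler_normD _ _) _; apply: lerD; first exact: h1.
  rewrite normrM mulrC (ger0_norm h0) ler_wpM2l//; exact: le_trans BX.
have key : `|S * D| <= (C + 2 * H) * X.
  have -> : S * D = expsum w k.+1 x - \sum_(t <- s) w t *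
     (derive1n k.+1 (fun y => expR (phase t 0 y)) x - (e t i0)%:R * D * expR (phase t 0 x)).
    rewrite /S /expsum -sumrB mulr_suml; apply: eq_bigr => t _ /=; ring.
  apply: le_trans (ler_normB _ _) _; rewrite mulrDl; apply: lerD.
    apply: le_trans (wC _) _; rewrite ler_wpM2l// ler_wpM2l// lerXn2r ?nnegrE//.
    by rewrite (le_trans rd)// ler_peMr.
  apply: le_trans (ler_norm_sum _ _ _) _.
  rewrite [leRHS](_ : _ = \sum_(t <- s) `|w t| * (2 * (expR (phase t 0 x) * X))); last first.
    by rewrite /H mulr_sumr mulr_suml; apply: eq_bigr => t _; ring.
  rewrite big_seq [leRHS]big_seq; apply: ler_sum => t ts.
  rewrite normrM ler_wpM2l//; exact: term.
have F0 : 0 < (k.+1)`!%:R * M ^+ k.+1 by rewrite mulr_gt0 ?exprn_gt0// ltr0n fact_gt0.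
rewrite -(ler_pM2r F0).
rewrite [leRHS](_ : _ = (C + 2 * H) * X); last by rewrite /X /B exprMn; ring.
apply: le_trans key; rewrite normrM -mulrA ler_wpM2l//.
apply: le_trans (ler_norm D); apply: le_trans hD.
by rewrite exprMn mulrCA.
Qed.

(** The peaks occur on a dense set, and the sum is continuous. *)
Lemma expsum_weight w (x0 d C r : R) (i0 : 'I_nv) : 0 <= C -> 0 <= r ->
  (forall x, `|x - x0| < d -> forall n, `|expsum w n x| <= C * (n`!%:R * r ^+ n)) ->
  forall x, `|x - x0| < d -> expsum (fun t => w t * (e t i0)%:R) 0 x = 0.
Proof.
move=> C0 r0 wC x xd; set S := expsum _ 0.
have cS : continuous S by apply: jet_continuous; exact: jet_expsum.
apply: contrapT => /eqP Sx.
have : \forall y \near x, S y != 0 by apply: (@cvgr_neq0 _ _ _ (nbhs x) _ S) Sx; exact: cS.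
move=> /(filterI (near_dist_lt xd)) /nbhs_ballP[eps /= eps0 Hb].
have [y yc yx] := dyadic_circle_dense x eps0.
have [/= yd /eqP] := Hb y (etrans (congr1 (< eps) (distrC x y)) yx).
by apply; apply: (expsum_peak i0 yc C0 r0) => n; apply: wC.
Qed.

Hypotheses (s_uniq : uniq s) (e_inj : injective e).

(** Among the weights q for which the sum of the w_t q_t exp F_t vanishes near
x0 is e t i0, and they are stable under multiplication by e t i, because a sum
that vanishes on a ball satisfies the bounds of expsum_weight with C = 0. *)
Lemma expsum_not_analytic w t0 i0 x0 : t0 \in s -> w t0 != 0 -> e t0 i0 != 0%N ->
  ~ analytic_at (expsum w 0) x0.
Proof.
move=> t0s wt0 et0 /(analytic_jet_bound (jet_expsum w))[d [C [r [dp C0 r0 wC]]]].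
pose vanishes (q : T -> R) :=
  forall x, `|x - x0| < d -> expsum (fun t => w t * q t) 0 x = 0.
have vanishesM (q : T -> R) i : vanishes q -> vanishes (fun t => q t * (e t i)%:R).
  move=> qv x xd.
  have q0 y : `|y - x0| < d -> forall n,
      `|expsum (fun t => w t * q t) n y| <= 0 * (n`!%:R * 0 ^+ n).
    by move=> yd n; rewrite (jet_zero_on_ball (jet_expsum _) qv)// normr0 mul0r.
  rewrite -[RHS](expsum_weight i (lexx 0) (lexx 0) q0 xd) /expsum.
  by apply: eq_bigr => t _; rewrite mulrA.
(* Multiplying by e t i - e t1 i, for an i where t1 differs from t0, kills t1
   and keeps t0; the initial weight e t i0 is nonzero at t0. *)
have isolate (l : seq T) : exists q, [/\ q t0 != 0,
    forall t, t \in l -> t != t0 -> q t = 0 & vanishes q].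
  elim: l => [|t1 l [q [q0 ql qv]]].
    exists (fun t => (e t i0)%:R); split => //; first by rewrite pnatr_eq0.
    by move=> x; apply: expsum_weight wC x.
  have [t10|t10] := eqVneq t1 t0.
    exists q; split => // t; rewrite inE t10 => /orP[->//|]; exact: ql.
  have [i ei] : exists i, e t0 i != e t1 i.
    apply: contrapT => H; move/eqP: t10; apply; apply: e_inj; apply/funext => i.
    by apply: contrapT => /eqP ei; apply: H; exists i; rewrite eq_sym.
  exists (fun t => q t * (e t i)%:R - (e t1 i)%:R * q t); split.
  - by rewrite [X in _ - X]mulrC -mulrBr mulf_neq0// subr_eq0 eqr_nat.
  - move=> t; rewrite inE => /orP[/eqP->|tl] tt0; first by rewrite mulrC subrr.
    by rewrite ql// mul0r mulr0 subrr.
  move=> x xd.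
  have -> : expsum (fun t => w t * (q t * (e t i)%:R - (e t1 i)%:R * q t)) 0 x =
      expsum (fun t => w t * (q t * (e t i)%:R)) 0 x -
      (e t1 i)%:R * expsum (fun t => w t * q t) 0 x.
    rewrite /expsum mulr_sumr -sumrB; apply: eq_bigr => t _; ring.
  by rewrite qv// vanishesM// mulr0 subrr.
have [q [q0 qs qv]] := isolate s.
have := qv x0; rewrite subrr normr0 => /(_ dp) /eqP; apply/negP.
rewrite /expsum (bigD1_seq t0)//= big_seq_cond big1 => [|t /andP[ts tt0]].
  by rewrite addr0 !mulf_neq0// gt_eqF// expR_gt0.
by rewrite qs// mulr0 mul0r.
Qed.

End exponential_sums.

(** * The generators *)

Definition generator (R : realType) (b : continuum) : R -> R :=
  fun x => expR (lacunary b 0 x).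

Lemma generator_polynomial_expsum (R : realType) (k : nat) (P : mpoly k R)
    (b : 'I_k -> continuum) :
  mmap (in_alg ((R -> R) : comAlgType R)) (fun i => generator (b i)) P =
  expsum b (msupp P) (fun m i => m i) (fun m => mcoeff m P) 0.
Proof.
apply/funext => x; rewrite mmap_fctE mevalE /expsum; apply: eq_bigr => m _.
congr (_ * _); rewrite /= /phase expR_sum; apply: eq_bigr => i _.
by rewrite /generator -expRM_natl mulr_natl.
Qed.

Lemma generator_polynomial_smooth_nowhere_analytic (R : realType) (k : nat)
    (P : mpoly k R) (b : 'I_k -> continuum) :
    injective b -> P != 0 -> mcoeff mnm0 P = 0 ->
  let g := mmap (in_alg ((R -> R) : comAlgType R)) (fun i => generator (b i)) P in
  smooth g /\ nowhere_analytic g.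
Proof.
move=> binj P0 Pc g; rewrite {}/g generator_polynomial_expsum.
split; first exact: (jet_smooth (jet_expsum _ _ _ _)).
move=> x0.
have [m mP] : exists m, mcoeff m P != 0.
  apply: contrapT => H; move/eqP: P0; apply; apply/mpolyP => m; rewrite mcoeff0.
  by apply: contrapT => /eqP mP; apply: H; exists m.
have [i mi] : exists i, m i != 0%N.
  apply: contrapT => H; move/eqP: mP; apply; rewrite -[RHS]Pc; congr mcoeff.
  by apply/mnmP => i; rewrite mnm0E; apply: contrapT => /eqP mi; apply: H; exists i.
apply: (expsum_not_analytic binj (msupp_uniq P) _ (t0 := m) (i0 := i)) => //.
- by move=> m1 m2 m12; apply/mnmP => j; exact: (congr1 (fun f => f j) m12).
- by rewrite mcoeff_msupp.
Qed.

Lemma analytic_at_zero (R : realType) (g : R -> R) (x0 : R) :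
  (forall x, g x = 0) -> analytic_at g x0.
Proof.
move=> g0; exists (fun=> 0); apply: (@filterE _ (nbhs x0)) => x; rewrite g0.
rewrite (_ : pseries _ _ = cst 0); first exact: cvg_cst.
by apply/funext => n; rewrite /pseries/series/= big1// => k _; rewrite mul0r.
Qed.

(** If two sequences gave the same generator, the polynomial X_0 - X_1 would
produce the zero function, which is analytic. *)
Lemma generator_inj (R : realType) : injective (@generator R).
Proof.
move=> b0 b1 b01; apply: contrapT => bne.
pose b (i : 'I_2) := if i == ord0 then b0 else b1.
have binj : injective b.
  have two (i : 'I_2) : i != ord0 -> i = ord_max.
    by move=> i0; apply: val_inj; case: i i0 => [[|[|]]].
  move=> i j; rewrite /b; have [->|/two ->] := eqVneq i ord0;
    have [->|/two ->] := eqVneq j ord0 => // H; by case: bne; rewrite H.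
pose P : mpoly 2 R := mpolyX R (mnm1 ord0) - mpolyX R (mnm1 ord_max).
have P0 : P != 0.
  rewrite subr_eq0; apply/eqP => /(congr1 (mcoeff (mnm1 ord0))).
  rewrite !mcoeffX eqxx; have -> : (mnm1 ord_max == mnm1 ord0 :> multinom 2) = false.
    by apply/eqP => /mnmP/(_ ord0); rewrite !mnmE.
  by move/eqP; rewrite oner_eq0.
have Pc : mcoeff mnm0 P = 0.
  by rewrite mcoeffB !mcoeffX !mnm1_eq0 subrr.
have [_ /(_ 0)] := generator_polynomial_smooth_nowhere_analytic binj P0 Pc.
apply; apply: analytic_at_zero => x.
by rewrite mmap_fctE mevalB !mevalXU /b/= b01 subrr.
Qed.

Theorem theorem4p10 (R : realType) :
  strongly_algebrable ((R -> R) : comAlgType R) continuum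
    [set g : R -> R | smooth g /\ nowhere_analytic g].
Proof.
exists (range (@generator R)); split.
  by apply: inj_card_eq => b b' _ _; exact: generator_inj.
move=> k P y k1 P0 Pc yinj yX.
have /choice[b bE] : forall i, exists c, generator c = y i.
  by move=> i; have [c _ <-] := yX i; exists c.
have binj : injective b by move=> i j bij; apply: yinj; rewrite -!bE bij.
have -> : y = fun i => generator (b i) by apply/funext => i; rewrite bE.
have [gs ga] := generator_polynomial_smooth_nowhere_analytic binj P0 Pc.
split; last by split.
by move=> g0; apply: (ga 0); apply: analytic_at_zero => x; rewrite g0.
Qed.
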